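(* Let $P$ be an integer and $p>3$ a prime. Then the sequence $[P,1]$ (i.e. $F_0=0$, $F_1=1$, $F_{n+1}=PF_n-F_{n-1}$ for $n\ge1$) is complete modulo $p$ if and only if $P\equiv \pm 2 \pmod p$.
   Context: A sequence $\{F_n\}_{n\ge 0}$ of integers is complete modulo a prime $p$ if for every integer $k$ there exists $n\ge 0$ with $F_n\equiv k \pmod p$. *)

(* Defs.v *)
From mathcomp Require Import all_boot all_order all_algebra.
Set Implicit Arguments.
Unset Strict Implicit.
Unset Printing Implicit Defensive.
Import GRing.Theory.
Local Open Scope ring_scope.

Definition complete_mod (p : nat) (F : nat -> int) : Prop :=
  forall k : int, exists n : nat, (F n = k %[mod p%:Z])%Z.

(* The Lucas sequence with parameters [P, 1]: characteristic polynomial X^2 - P X + 1. *)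
Fixpoint seqP1 (P : int) (n : nat) : int :=
  match n with
  | 0 => 0
  | 1 => 1
  | (m.+1 as k).+1 => P * seqP1 P k - seqP1 P m
  end.

(* Main.v *)
(* The invariant F_{n+1}^2 - P F_n F_{n+1} + F_n^2 = 1 shows that every term x
   satisfies: 4 + D x^2 is a square, where D = P^2 - 4.  If the sequence is
   complete and D <> 0 mod p, then s |-> 4 + D s is an injection, hence a
   permutation, of the set S of squares of F_p.  Summing over S gives
   sum S = 4 |S| + D sum S.  But sum S = 0, because multiplication by 4 permutes
   S and 4 <> 1; so p divides |S|, although 0 < |S| < p.  Conversely, for
   P = 2 (resp. -2) the terms are n (resp. (-1)^(n+1) n). *)
Require Import Defs.
From mathcomp Require Import all_boot all_order all_algebra.
From mathcomp Require Import ring.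
Import GRing.Theory.
Local Open Scope ring_scope.

Section Squares.

Variable F : finFieldType.

Definition squares : {set F} := [set x ^+ 2 | x : F].

Lemma card_squares_gt0 : (0 < #|squares|)%N.
Proof. by apply/card_gt0P; exists (0 ^+ 2); apply: imset_f. Qed.

(** Squaring is not injective: it identifies 1 and -1, which differ when 2 is nonzero. *)
Lemma card_squares_lt : (2 : F) != 0 -> (#|squares| < #|F|)%N.
Proof.
move=> two_neq0; rewrite ltn_neqAle leq_imset_card andbT.
apply/negP => /imset_injP inj_sqr.
have /eqP: (1 : F) = - 1 by apply: inj_sqr => //; rewrite sqrrN.
by rewrite -subr_eq0 opprK -[1 + 1]/(2 : F) (negPf two_neq0).
Qed.

(** By finiteness, an injection of [S] into itself is a permutation of [S]. *)
Lemma sum_permuted (S : {set F}) (f : F -> F) :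
  injective f -> {in S, forall s, f s \in S} -> \sum_(s in S) f s = \sum_(s in S) s.
Proof.
move=> inj_f fS.
have imfS: f @: S = S.
  apply/eqP; rewrite eqEcard card_imset // leqnn andbT.
  by apply/subsetP => _ /imsetP[s sS ->]; apply: fS.
by rewrite -{2}imfS big_imset //= => x y _ _; apply: inj_f.
Qed.

Lemma sum_squares : (2 : F) != 0 -> (3 : F) != 0 -> \sum_(s in squares) s = 0.
Proof.
move=> two_neq0 three_neq0.
have four_neq0: (4 : F) != 0 by rewrite (natrM F 2 2) mulf_neq0.
have E: \sum_(s in squares) 4 * s = \sum_(s in squares) s.
  apply: sum_permuted; first exact: mulfI.
  move=> _ /imsetP[x _ ->]; apply/imsetP; exists (2 * x) => //; ring.
apply: (mulfI three_neq0); rewrite mulr0.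
have -> : (3 : F) = 4 - 1 by ring.
by rewrite mulrBl mul1r mulr_sumr E subrr.
Qed.

Lemma card_squares_eq0 (D : F) : (2 : F) != 0 -> (3 : F) != 0 -> D != 0 ->
  (forall x, exists y, y ^+ 2 = 4 + D * x ^+ 2) -> #|squares|%:R = 0 :> F.
Proof.
move=> two_neq0 three_neq0 D_neq0 sqrD.
have: \sum_(s in squares) (4 + D * s) = \sum_(s in squares) s.
  apply: sum_permuted => [x y /addrI|_ /imsetP[x _ ->]]; first exact: mulfI.
  by have [y <-] := sqrD x; apply: imset_f.
(* What remains is [4 * #|squares| = 0], and 4 = 2 * 2 is nonzero. *)
rewrite big_split /= -mulr_sumr sum_squares // mulr0 addr0 sumr_const.
rewrite -[LHS]mulr_natl => /eqP; rewrite mulf_eq0 (natrM F 2 2) mulf_eq0.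
by rewrite (negPf two_neq0) !orbF => /eqP.
Qed.

End Squares.

Lemma seqP1_invariant (P : int) n :
  seqP1 P n.+1 ^+ 2 - P * seqP1 P n * seqP1 P n.+1 + seqP1 P n ^+ 2 = 1.
Proof.
elim: n => [|n IHn]; first by rewrite /=; ring.
rewrite -[RHS]IHn -[seqP1 P n.+2]/(P * seqP1 P n.+1 - seqP1 P n); ring.
Qed.

Lemma seqP1_discr (P : int) n :
  exists y, y ^+ 2 = 4 + (P ^+ 2 - 4) * seqP1 P n ^+ 2.
Proof.
(* Completing the square: four times the invariant is (2 F_{n+1} - P F_n)^2 - (P^2 - 4) F_n^2. *)
exists (2 * seqP1 P n.+1 - P * seqP1 P n).
rewrite -[X in _ = X + _]mulr1 -[X in _ = _ * X + _](seqP1_invariant P n).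
ring.
Qed.

(** Here X^2 - P X + 1 = (X - e)^2 has the double root [e], whence F_n = n e^(n-1); the extra factor
    [e] avoids the exponent n - 1 at n = 0. *)
Lemma seqP1_double_root (R : comNzRingType) (P : int) (e : R) n :
  e ^+ 2 = 1 -> P%:~R = 2 * e -> e * (seqP1 P n)%:~R = e ^+ n * n%:R.
Proof.
move=> e2 Pe.
suff [] : e * (seqP1 P n)%:~R = e ^+ n * n%:R /\
          e * (seqP1 P n.+1)%:~R = e ^+ n.+1 * n.+1%:R by [].
elim: n => [|n [IHn IHn1]]; first by rewrite /= !mulr0 expr1.
split=> //; rewrite -[seqP1 P n.+2]/(P * seqP1 P n.+1 - seqP1 P n).
rewrite rmorphB rmorphM /= Pe mulrBr mulrCA IHn IHn1.
(* Inserting [e ^+ 2 = 1] in the subtracted term gives every term the factor e^(n+2). *)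
rewrite -[X in _ - X]mul1r -[X in _ - X * _]e2 !exprS -!natr1; ring.
Qed.

Lemma eqz_mod_Fp (p : nat) (x y : int) : prime p ->
  (x = y %[mod p%:Z])%Z <-> x%:~R = y%:~R :> 'F_p.
Proof.
move=> p_prime; split=> /eqP E; apply/eqP; move: E;
  by rewrite eqz_mod_dvd (dvdz_pcharf (pchar_Fp p_prime)) rmorphB subr_eq0.
Qed.

Theorem theorem2 (P : int) (p : nat) (p_prime : prime p) (p_gt3 : (3 < p)%N) :
  complete_mod p (seqP1 P) <->
  (P = 2 %[mod p%:Z])%Z \/ (P = - 2 %[mod p%:Z])%Z.
Proof.
have natF_eq0 n : (n%:R == 0 :> 'F_p) = (p %| n)%N.
  by rewrite (dvdn_pcharf (pchar_Fp p_prime)).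
have two_neq0: (2 : 'F_p) != 0 by rewrite natF_eq0 gtnNdvd // ltnW.
have three_neq0: (3 : 'F_p) != 0 by rewrite natF_eq0 gtnNdvd.
rewrite !eqz_mod_Fp //; split=> [complP|Peq2 k].
  have [D0|D_neq0] := eqVneq ((P%:~R : 'F_p) ^+ 2 - 4) 0.
    have: ((P%:~R : 'F_p) - 2) * (P%:~R + 2) = 0 by rewrite -D0; ring.
    move/eqP; rewrite mulf_eq0 subr_eq0 addr_eq0.
    by case/orP=> /eqP ->; [left | right].
  have: #|squares 'F_p|%:R = 0 :> 'F_p.
    apply: card_squares_eq0 D_neq0 _ => // x.
    (* Completeness at the canonical representative of [x] makes [x] the residue of a term. *)
    have [n /eqz_mod_Fp Fn] := complP (x : nat)%:Z.
    have [y Ey] := seqP1_discr P n; exists (y%:~R).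
    rewrite -[x]natr_Zp -[(nat_of_ord x)%:R]/((x : nat)%:Z%:~R) -Fn //.
    by rewrite -rmorphXn Ey rmorphD rmorphM rmorphB !rmorphXn.
  move/eqP; rewrite natF_eq0 gtnNdvd ?card_squares_gt0 //.
  by rewrite -[X in (_ < X)%N](card_Fp p_prime) card_squares_lt.
(* The sign [e] treats both cases at once. *)
have [e e2 Pe]: exists2 e : 'F_p, e ^+ 2 = 1 & P%:~R = 2 * e.
  case: Peq2 => ->; [exists 1 | exists (-1)]; rewrite ?mulr1 ?mulrN1 ?expr1n //.
  by rewrite sqrrN expr1n.
(* Among m and m + p one is odd, and for odd n the term is n whether P is 2 or -2. *)
set m : nat := (k%:~R : 'F_p).
have [n odd_n n_k]: exists2 n, odd n & n%:R = k%:~R :> 'F_p.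
  have odd_p: odd p by case: (even_prime p_prime) p_gt3 => [->|].
  have m_k: m%:R = k%:~R :> 'F_p by rewrite natr_Zp.
  have [odd_m|even_m] := boolP (odd m); first by exists m.
  exists (m + p)%N; first by rewrite oddD odd_p addbT.
  by rewrite natrD m_k pchar_Fp_0 ?addr0.
exists n; apply/eqz_mod_Fp => //.
have e_n: e ^+ n = e.
  by rewrite -[n]odd_double_half odd_n -muln2 mulnC exprD exprM e2 expr1n mulr1.
have e_neq0: e != 0 by rewrite -sqrf_eq0 e2 oner_neq0.
by apply: (mulfI e_neq0); rewrite (seqP1_double_root _ _ _ _ e2 Pe) e_n n_k.
Qed.
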